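(* Let $\mathcal D$ be a convex and weakly compact ambiguity set of probability measures on $(\mathcal S,\mathcal F)$, where $\mathcal S$ is a compact metric space (the support set of $\xi$) and $\mathcal F$ is its Borel $\sigma$-algebra. Then the pessimistic distributionally robust bilevel program $$(\mathcal P):\quad \min_{x\in\mathcal X}\ w^\top x+\sup_{F\in\mathcal D}\mathbb E_F\Big[\max_{y\in\Omega(x,\xi)}v(\xi)^\top y\Big]$$ is equivalent to the two-stage distributionally robust stochastic program $$\min_{x\in\mathcal X,\ \lambda\ge0}\Big\{w^\top x+\sup_{F\in\mathcal D}\mathbb E_F\big[\Phi_\lambda(x,\xi)\big]\Big\}.$$
   Context: Setting. $\mathcal X\subseteq\{0,1\}^d$ is the leader's feasible set, $w\in\mathbb R^d$, $\xi$ is a random vector with values in $\mathcal S\subseteq\mathbb R^k$, and $\mathbb E_F$ is expectation when $\xi$ has distribution $F$. $A\in\mathbb R^{m\times n}$. The data are affine in $\xi$: $c(\xi)=C\xi+c_0$, $v(\xi)=V\xi+v_0$ with $C,V\in\mathbb R^{n\times k}$, $c_0,v_0\in\mathbb R^n$; $b_x(\xi)=B_x\xi+b_{x0}$ with $B_x=\sum_{i=1}^d B_ix_i+B_0$, $b_{x0}=\sum_{i=1}^d b_ix_i+b_0$, $B_i\in\mathbb R^{m\times k}$, $b_i\in\mathbb R^m$ ($i=0,\dots,d$). Standing assumptions. (1) For every $F\in\mathcal D$ and $x\in\mathcal X$, $c(\xi),v(\xi),b_x(\xi)$ are square-integrable with respect to $F$. (2) Relatively complete recourse: for every $x\in\mathcal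 X$ and every $F\in\mathcal D$, the set $\{y\in\mathbb R^n: Ay\le b_x(\xi)\}$ is nonempty and bounded almost surely. (The boundedness is equivalent to $\{y: Ay\le 0\}=\{0\}$, and to $\{A^\top p: p\ge 0,\ p\in\mathbb R^m\}=\mathbb R^n$.) Definitions. $\Omega(x,\xi)=\arg\min_y\{c(\xi)^\top y: Ay\le b_x(\xi)\}$ (set of all optimal solutions), and for $\lambda\ge0$ $$\Phi_\lambda(x,\xi)=\min_{p\in\mathbb R^m,\,y\in\mathbb R^n}\{b_x(\xi)^\top p+c(\xi)^\top y:\ A^\top p+\lambda c(\xi)=v(\xi),\ p\ge0,\ Ay\le\lambda b_x(\xi)\}.$$ Equivalence means equality of optimal values, with the same optimal leader's decisions $x$. *)

(* Defs.v *)
From HB Require Import structures.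
From mathcomp Require Import all_boot all_order all_algebra.
From mathcomp Require Import all_classical all_reals all_analysis.

Set Implicit Arguments.
Unset Strict Implicit.
Unset Printing Implicit Defensive.

Import Order.TTheory GRing.Theory Num.Theory.
Import numFieldNormedType.Exports.

Local Open Scope classical_set_scope.
Local Open Scope ring_scope.

(* The subspace S of T, with its subspace topology.  The point s0 of S is here
   only because measurable types are pointed in the library; neither the
   topology nor the Borel sigma-algebra depends on it. *)
Definition pointed_subspace (T : topologicalType) (S : set T) (s0 : S) : Type :=
  set_type S.

HB.instance Definition _ (T : topologicalType) (S : set T) (s0 : S) :=
  Topological.copy (pointed_subspace s0) (set_type S).
HB.instance Definition _ (T : topologicalType) (S : set T) (s0 : S) :=
  isPointed.Build (pointed_subspace s0) s0.

Definition borel (X : ptopologicalType) := g_sigma_algebraType (@open X).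

Section WeakTopology.
Variables (R : realType) (X : ptopologicalType).

Definition bounded_continuous : set (X -> R) :=
  [set f | continuous f /\ [bounded f x | x in [set: X]]].

Definition integrate_against (F : probability (borel X) R) :
    {ptws bounded_continuous -> R} :=
  fun f => \int[F]_(x in [set: borel X]) set_val f x.

(* The topology of weak convergence of probability measures: the coarsest one
   that makes F |-> \int f dF continuous for all bounded continuous f. *)
Definition weak_probability : topologicalType :=
  initial_topology integrate_against.

Definition weakly_compact (D : set (probability (borel X) R)) : Prop :=
  compact (D : set weak_probability).

(* Measures are compared on measurable sets only: elsewhere their values are
   not determined. *)
Definition convex_probabilities (D : set (probability (borel X) R)) : Prop :=
  forall F G : probability (borel X) R, D F -> D G ->
  forall t : R, 0 <= t <= 1 ->
  exists2 H : probability (borel X) R, D H &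
    forall U : set (borel X), measurable U ->
      H U = (t%:E * F U + (1 - t)%:E * G U)%E.

End WeakTopology.

Definition dotv (R : realType) (n : nat) (u v : 'cV[R]_n) : R :=
  (u^T *m v) 0 0.

Definition lev (R : realType) (n : nat) (u v : 'cV[R]_n) : Prop :=
  forall i, u i 0 <= v i 0.

Record bilevel_data (R : realType) (d k m n : nat) := BilevelData {
  leader_set : set 'cV[R]_d;
  leader_cost : 'cV[R]_d;
  matA : 'M[R]_(m, n);
  matC : 'M[R]_(n, k);
  vecc0 : 'cV[R]_n;
  matV : 'M[R]_(n, k);
  vecv0 : 'cV[R]_n;
  matB : 'I_d -> 'M[R]_(m, k);
  matB0 : 'M[R]_(m, k);
  vecb : 'I_d -> 'cV[R]_m;
  vecb0 : 'cV[R]_m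
}.

Section Bilevel.
Variables (R : realType) (d k m n : nat) (P : bilevel_data R d k m n).
Implicit Types (x : 'cV[R]_d) (xi : 'cV[R]_k) (y : 'cV[R]_n) (p : 'cV[R]_m)
  (lambda : R).

Definition cost xi : 'cV[R]_n := matC P *m xi + vecc0 P.

Definition payoff xi : 'cV[R]_n := matV P *m xi + vecv0 P.

Definition rhs x xi : 'cV[R]_m :=
  (\sum_(i < d) x i 0 *: matB P i + matB0 P) *m xi +
  (\sum_(i < d) x i 0 *: vecb P i + vecb0 P).

Definition binary_leader : Prop :=
  forall x, leader_set P x -> forall i, x i 0 = 0 \/ x i 0 = 1.

Definition follower_feasible x xi : set 'cV[R]_n :=
  [set y | lev (matA P *m y) (rhs x xi)].

Definition Omega x xi : set 'cV[R]_n :=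
  [set y | follower_feasible x xi y /\
    forall y', follower_feasible x xi y' ->
      dotv (cost xi) y <= dotv (cost xi) y'].

(* Inner maxima and minima are taken in \bar R, so that they also make sense on
   the null set of scenarios where the follower's problem is infeasible. *)
Definition pessimistic_value x xi : \bar R :=
  ereal_sup [set (dotv (payoff xi) y)%:E | y in Omega x xi].

Definition Phi_feasible lambda x xi : set ('cV[R]_m * 'cV[R]_n) :=
  [set q | [/\ (matA P)^T *m q.1 + lambda *: cost xi = payoff xi,
               lev 0 q.1 &
               lev (matA P *m q.2) (lambda *: rhs x xi)]].

Definition Phi lambda x xi : \bar R :=
  ereal_inf [set (dotv (rhs x xi) q.1 + dotv (cost xi) q.2)%:E
            | q in Phi_feasible lambda x xi].

Section Ambiguity.
Variables (S : set 'cV[R]_k) (s0 : S).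
Local Notation Sspace := (borel (pointed_subspace s0)).
Variable D : set (probability Sspace R).

(* A scenario s : S is the realisation [set_val s] of the random vector, whose
   distribution under F is thus F itself. *)
Definition square_integrable (F : probability Sspace R) (q : nat)
    (g : 'cV[R]_k -> 'cV[R]_q) : Prop :=
  forall i, (fun s : Sspace => g (set_val s) i 0) \in Lfun F 2%:E.

Definition square_integrable_data : Prop :=
  forall F x, D F -> leader_set P x ->
    [/\ square_integrable F cost,
        square_integrable F payoff &
        square_integrable F (rhs x)].

Definition relatively_complete_recourse : Prop :=
  forall x F, leader_set P x -> D F ->
    {ae F, forall s : Sspace,
      follower_feasible x (set_val s) !=set0 /\
      bounded_set (follower_feasible x (set_val s))}.

Definition worst_case (h : 'cV[R]_k -> \bar R) : \bar R :=
  ereal_sup [set (\int[F]_s h (set_val s))%E | F in D].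

Definition bilevel_objective x : \bar R :=
  ((dotv (leader_cost P) x)%:E + worst_case (pessimistic_value x))%E.

Definition two_stage_objective x lambda : \bar R :=
  ((dotv (leader_cost P) x)%:E + worst_case (Phi lambda x))%E.

Definition bilevel_optval : \bar R :=
  ereal_inf [set bilevel_objective x | x in leader_set P].

Definition two_stage_optval : \bar R :=
  ereal_inf [set two_stage_objective z.1 z.2
            | z in leader_set P `*` [set lambda : R | 0 <= lambda]].

Definition bilevel_optimal x : Prop :=
  leader_set P x /\ bilevel_objective x = bilevel_optval.

(* The infimum over lambda need not be attained, even when x is optimal, so
   optimality of x is that of the partially minimised objective. *)
Definition two_stage_optimal x : Prop :=
  leader_set P x /\
  ereal_inf [set two_stage_objective x lambda
            | lambda in [set lambda : R | 0 <= lambda]] = two_stage_optval.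

Definition equivalent_programs : Prop :=
  bilevel_optval = two_stage_optval /\
  forall x, bilevel_optimal x <-> two_stage_optimal x.

End Ambiguity.
End Bilevel.

(* Main.v *)
Require Import Defs.
From mathcomp Require Import all_boot all_order all_algebra.
From mathcomp Require Import all_classical all_reals all_analysis.
From mathcomp Require Import measurable_realfun ring lra.

Set Implicit Arguments.
Unset Strict Implicit.
Unset Printing Implicit Defensive.

Import Order.TTheory GRing.Theory Num.Theory.
Import numFieldNormedType.Exports.
Local Open Scope classical_set_scope.
Local Open Scope ring_scope.

(* Fix [x].  By linear programming duality [Phi lambda x] is, on scenarios with a
   feasible follower, nonincreasing in [lambda], bounded below by the pessimistic
   value and equal to it for large [lambda].  It is also Lipschitz there, because
   dual solutions can be chosen bounded (Carathéodory), so it agrees almost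
   surely with a bounded continuous function of the scenario.  Hence
   [F |-> E_F Phi] is weakly continuous on [D] and decreases pointwise in [lambda]
   to [E_F] of the pessimistic value; as [D] is weakly compact, Dini's argument
   exchanges the infimum over [lambda] with the supremum over [F]. *)

(** * Inner product and componentwise order of column vectors *)

Section Dot.
Variable R : realType.

Lemma dotvE n (u v : 'cV[R]_n) : dotv u v = \sum_i u i 0 * v i 0.
Proof. by rewrite /dotv mxE; apply: eq_bigr => i _; rewrite mxE. Qed.

Lemma dotvC n (u v : 'cV[R]_n) : dotv u v = dotv v u.
Proof. by rewrite !dotvE; apply: eq_bigr => i _; rewrite mulrC. Qed.

Lemma dotvDl n (u v w : 'cV[R]_n) : dotv (u + v) w = dotv u w + dotv v w.
Proof. by rewrite /dotv linearD mulmxDl mxE. Qed.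

Lemma dotvZl n a (u w : 'cV[R]_n) : dotv (a *: u) w = a * dotv u w.
Proof. by rewrite /dotv linearZ -scalemxAl mxE. Qed.

Lemma dotvDr n (u v w : 'cV[R]_n) : dotv w (u + v) = dotv w u + dotv w v.
Proof. by rewrite dotvC dotvDl !(dotvC w). Qed.

Lemma dotvZr n a (u w : 'cV[R]_n) : dotv w (a *: u) = a * dotv w u.
Proof. by rewrite dotvC dotvZl (dotvC w). Qed.

Lemma dotvNl n (u w : 'cV[R]_n) : dotv (- u) w = - dotv u w.
Proof. by rewrite -scaleN1r dotvZl mulN1r. Qed.

Lemma dotvNr n (u w : 'cV[R]_n) : dotv w (- u) = - dotv w u.
Proof. by rewrite dotvC dotvNl dotvC. Qed.

Lemma dot0v n (w : 'cV[R]_n) : dotv 0 w = 0.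
Proof. by rewrite -(scale0r 0) dotvZl mul0r. Qed.

Lemma dotv0 n (w : 'cV[R]_n) : dotv w 0 = 0.
Proof. by rewrite dotvC dot0v. Qed.

Lemma dotv_tr m n (A : 'M[R]_(m, n)) p y :
  dotv (A^T *m p) y = dotv p (A *m y).
Proof. by rewrite /dotv trmx_mul trmxK mulmxA. Qed.

Lemma dotv_col m n (u u' : 'cV[R]_m) (v v' : 'cV[R]_n) :
  dotv (col_mx u v) (col_mx u' v') = dotv u u' + dotv v v'.
Proof. by rewrite /dotv tr_col_mx mul_row_col mxE. Qed.

Lemma dotv1 (u v : 'cV[R]_1) : dotv u v = u 0 0 * v 0 0.
Proof. by rewrite dotvE big_ord1. Qed.

Lemma lev_dot n (p u v : 'cV[R]_n) : lev 0 p -> lev u v -> dotv p u <= dotv p v.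
Proof.
move=> p0 uv; rewrite !dotvE; apply: ler_sum => i _; apply: ler_wpM2l => //.
by have := p0 i; rewrite mxE.
Qed.

Lemma levD n (u u' v v' : 'cV[R]_n) : lev u v -> lev u' v' -> lev (u + u') (v + v').
Proof. by move=> h h' i; rewrite !mxE lerD. Qed.

Lemma levZ n a (u v : 'cV[R]_n) : 0 <= a -> lev u v -> lev (a *: u) (a *: v).
Proof. by move=> a0 h i; rewrite !mxE ler_wpM2l. Qed.

Lemma lev_col m n (u u' : 'cV[R]_m) (v v' : 'cV[R]_n) :
  lev (col_mx u v) (col_mx u' v') <-> lev u u' /\ lev v v'.
Proof.
split=> [h|[h h'] i].
  by split=> i; [have := h (lshift _ i)|have := h (rshift _ i)];
    rewrite ?col_mxEu ?col_mxEd.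
by case: (split_ordP i) => j ->; rewrite ?col_mxEu ?col_mxEd.
Qed.

Lemma lev0_col m n (u : 'cV[R]_m) (v : 'cV[R]_n) :
  lev 0 (col_mx u v) <-> lev 0 u /\ lev 0 v.
Proof. by rewrite -[X in lev X _](@col_mx0 R m n 1); exact: lev_col. Qed.

Lemma lev_col0 m n (u : 'cV[R]_m) (v : 'cV[R]_n) :
  lev (col_mx u v) 0 <-> lev u 0 /\ lev v 0.
Proof. by rewrite -[X in lev _ X](@col_mx0 R m n 1); exact: lev_col. Qed.

End Dot.

(** * Theorems of the alternative for linear inequalities *)

Section Farkas.
Variable R : realType.

(* Bartl's induction: eliminate one generator [a] by projecting along a vector
   separating [u] from the other generators. *)
Lemma farkas m n (A : 'M[R]_(m, n)) (u : 'cV[R]_n) :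
  (exists2 p, lev 0 p & A^T *m p = u) \/
  (exists2 z, lev (A *m z) 0 & 0 < dotv u z).
Proof.
elim: m A u => [|m IH] A u.
  have [->|/eqP u0] := eqVneq u 0.
    by left; exists 0 => //; rewrite mulmx0.
  right; exists u; first by case.
  rewrite dotvE lt_neqAle sumr_ge0 ?andbT => [|i _]; last exact: sqr_ge0.
  apply/eqP => /esym /eqP; rewrite psumr_eq0 => [/allP h|i _]; last exact: sqr_ge0.
  apply: u0; apply/matrixP => i j; rewrite (ord1 j) !mxE.
  by have := h i (mem_index_enum _); rewrite -expr2 sqrf_eq0 => /eqP.
rewrite -[m.+1]/(1 + m)%N in A *; rewrite -[A]vsubmxK.
set a := usubmx _; set B := dsubmx _.
have [[p p0 Bp]|[z0 Bz0 uz0]] := IH B u.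
  left; exists (col_mx (0 : 'cV_1) p); first by apply/(@lev0_col _ 1 m); split.
  by rewrite tr_col_mx mul_row_col mulmx0 add0r.
have az (z : 'cV[R]_n) : a *m z = (dotv a^T z)%:M.
  by rewrite [LHS]mx11_scalar /dotv trmxK.
have [az0|az0] := leP (dotv a^T z0) 0.
  right; exists z0 => //; rewrite mul_col_mx; apply/(@lev_col0 _ 1 m); split=> //.
  by move=> i; rewrite az ord1 !mxE eqxx.
(* Normalised so that [a *m z1 = 1]: subtracting multiples of [z1] projects onto the kernel of
   [a]. *)
pose z1 := (dotv a^T z0)^-1 *: z0.
have az1 : dotv a^T z1 = 1 by rewrite dotvZr mulVf ?gt_eqF.
have uz1 : 0 < dotv u z1 by rewrite dotvZr mulr_gt0 ?invr_gt0.
have Bz1 : lev (B *m z1) 0.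
  rewrite -scalemxAr -(scaler0 _ (dotv a^T z0)^-1).
  by apply: levZ => //; rewrite invr_ge0 ltW.
pose B' := B - (B *m z1) *m a; pose u' := u - dotv u z1 *: a^T.
have [[p p0 Bp]|[z Bz uz]] := IH B' u'.
  (* The multiplier of [a] undoes the projection; it is nonnegative because [dotv u z1 > 0] and
     [B *m z1 <= 0]. *)
  left; exists (col_mx (dotv u z1 - dotv p (B *m z1))%:M p).
    apply/(@lev0_col _ 1 m); split=> // i; rewrite ord1 !mxE eqxx subr_ge0.
    by apply: le_trans (ltW uz1); rewrite -(dotv0 p); apply: lev_dot.
  rewrite tr_col_mx mul_row_col mul_mx_scalar.
  move: Bp; rewrite /B' /u' linearB /= mulmxBl trmx_mul -mulmxA.
  have -> : (B *m z1)^T *m p = (dotv p (B *m z1))%:M.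
    by rewrite dotvC [LHS]mx11_scalar.
  rewrite mul_mx_scalar => /eqP; rewrite subr_eq => /eqP ->.
  rewrite scalerBl; apply/matrixP=> i j; rewrite !mxE; ring.
right; exists (z - dotv a^T z *: z1).
  rewrite mul_col_mx; apply/(@lev_col0 _ 1 m); split.
    by move=> i; rewrite az ord1 !mxE eqxx /= dotvDr dotvNr dotvZr az1 mulr1 subrr.
  have -> : B *m (z - dotv a^T z *: z1) = B' *m z; last by [].
    by rewrite /B' mulmxBr mulmxBl -(mulmxA _ a) az mul_mx_scalar -scalemxAr.
move: uz; rewrite /u' !(dotvDr, dotvDl, dotvNl, dotvNr, dotvZl, dotvZr).
by congr (_ < _); rewrite mulrC.
Qed.

(** Homogenise with a last coordinate [t]: a vector [(y, t)] separating [(0, 1)] from the rows of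
    [(A, -b)] has [t > 0], and [y / t] is feasible. *)
Lemma farkas_feasible m n (A : 'M[R]_(m, n)) (b : 'cV[R]_m) :
  (exists y, lev (A *m y) b) \/
  (exists p, [/\ lev 0 p, A^T *m p = 0 & dotv b p < 0]).
Proof.
have [[p p0]|[z]] := farkas (row_mx A (- b)) (col_mx 0 1 : 'cV[R]_(n + 1)).
  rewrite tr_row_mx mul_col_mx => /eq_col_mx[Ap bp]; right; exists p; split=> //.
  have : ((- b)^T *m p) 0 0 = 1 by rewrite bp mxE.
  rewrite -/(dotv _ _) dotvNl => /eqP; rewrite eqr_oppLR => /eqP ->.
  by rewrite oppr_lt0.
rewrite -[z]vsubmxK; set y := usubmx z; set t := dsubmx z.
rewrite mul_row_col dotv_col dot0v add0r dotv1 [X in X * _]mxE mul1r => h t0.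
left; exists ((t 0 0)^-1 *: y) => i.
have := h i; rewrite [t]mx11_scalar mul_mx_scalar -scalemxAr scalerN !mxE subr_le0.
by rewrite ler_pdivrMl ?eqxx ?mulr1n //; move: t0; rewrite mxE.
Qed.

Lemma farkas_valid m n (A : 'M[R]_(m, n)) (b : 'cV[R]_m) (u : 'cV[R]_n) y0 mu :
  lev (A *m y0) b -> (forall y, lev (A *m y) b -> dotv u y <= mu) ->
  exists p, [/\ lev 0 p, A^T *m p = u & dotv b p <= mu].
Proof.
move=> Ay0 umu.
(* The alternative for [M] yields either the multipliers, with the second row as slack in
   [dotv b p <= mu], or [(y, t)] with [A *m y <= t b], [t >= 0] and [dotv u y > mu t]. *)
pose M := block_mx A (- b) 0 (- 1) : 'M[R]_(m + 1, n + 1).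
have [[p]|[z]] := farkas M (col_mx u (- mu%:M)).
  rewrite -[p]vsubmxK; set q := usubmx p; set s := dsubmx p.
  move=> /lev0_col[q0 s0]; rewrite tr_block_mx mul_block_col => /eq_col_mx[].
  rewrite trmx0 mul0mx addr0 => Aq bq; exists q; split=> //.
  have : ((- b)^T *m q + (- 1)^T *m s) 0 0 = - mu by rewrite bq !mxE eqxx.
  rewrite mxE -!/(dotv _ _) dotvNl dotv1 !mxE eqxx mulr1n.
by have := s0 0; rewrite !mxE; lra.
rewrite -[z]vsubmxK; set y := usubmx z; set t := dsubmx z.
rewrite mul_block_col mul0mx add0r => /lev_col0[h ht].
rewrite dotv_col dotv1 (_ : (- mu%:M) 0 0 = - mu) => [uy|]; last first.
  by rewrite !mxE eqxx mulr1n.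
have t0 : 0 <= t 0 0 by have := ht 0; rewrite mulNmx mul1mx !mxE oppr_le0.
have {}h : lev (A *m y) (t 0 0 *: b).
  move=> i; have := h i.
  by rewrite [t]mx11_scalar mul_mx_scalar scalerN !mxE subr_le0 eqxx mulr1n.
(* If [t > 0], the point [y / t] violates the bound; if [t = 0], [y] is a recession direction along
   which [u] grows from [y0]. *)
exfalso; have [t00|tpos] := leP (t 0 0) 0; last first.
  have : dotv u ((t 0 0)^-1 *: y) <= mu.
    apply: umu; rewrite -scalemxAr -[b](scalerK (lt0r_neq0 tpos)).
    by apply: levZ => //; rewrite invr_ge0.
  by rewrite dotvZr ler_pdivrMl // => ?; lra.
have tz : t 0 0 = 0 by apply/eqP; rewrite eq_le t00.
move: h uy; rewrite tz scale0r mulr0 addr0 => Ay uy.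
have hmu := umu _ Ay0.
(* Chosen so that [u] takes the value [mu + 1] at [y0 + r *: y]. *)
pose r := (mu - dotv u y0 + 1) / dotv u y.
have r0 : 0 <= r by rewrite divr_ge0 ?ltW //; lra.
have : dotv u (y0 + r *: y) <= mu.
  apply: umu; rewrite mulmxDr -scalemxAr -[b]addr0 -(scaler0 _ r).
  by apply: levD => //; apply: levZ.
by rewrite dotvDr dotvZr /r divfK ?gt_eqF //; lra.
Qed.

End Farkas.

(** * Bounded multipliers by Carathéodory reduction *)

Section Caratheodory.
Variable R : realType.

(** The l1 norm pairs with coordinatewise bounds on multipliers; the ambient norm on column vectors
    is the maximum norm. *)
Definition norm1 n (u : 'cV[R]_n) : R := \sum_i `|u i 0|.

Lemma norm1_ge0 n (u : 'cV[R]_n) : 0 <= norm1 u.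
Proof. exact: sumr_ge0. Qed.

Lemma norm1D n (u v : 'cV[R]_n) : norm1 (u + v) <= norm1 u + norm1 v.
Proof.
rewrite /norm1 -big_split /=; apply: ler_sum => i _; rewrite mxE.
exact: ler_normD.
Qed.

Lemma norm1Z n a (u : 'cV[R]_n) : norm1 (a *: u) = `|a| * norm1 u.
Proof. by rewrite /norm1 mulr_sumr; apply: eq_bigr => i _; rewrite mxE normrM. Qed.

Lemma norm1_coord n (u : 'cV[R]_n) i : `|u i 0| <= norm1 u.
Proof. by rewrite /norm1 (bigD1 i) //= lerDl sumr_ge0. Qed.

Lemma dotv_le_norm1 n (u v : 'cV[R]_n) M :
  (forall i, `|u i 0| <= M) -> `|dotv u v| <= M * norm1 v.
Proof.
move=> uM; rewrite dotvE (le_trans (ler_norm_sum _ _ _))// mulr_sumr.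
by apply: ler_sum => i _; rewrite normrM ler_wpM2r.
Qed.

Definition entry_sum m n (B : 'M[R]_(m, n)) : R := \sum_i \sum_j `|B i j|.

Lemma entry_sum_ge0 m n (B : 'M[R]_(m, n)) : 0 <= entry_sum B.
Proof. by apply: sumr_ge0 => i _; apply: sumr_ge0. Qed.

Lemma norm1_mulmx m n (B : 'M[R]_(m, n)) (w : 'cV[R]_n) M :
  (forall j, `|w j 0| <= M) -> norm1 (B *m w) <= entry_sum B * M.
Proof.
move=> wM; rewrite /entry_sum /norm1 mulr_suml; apply: ler_sum => i _.
rewrite mxE (le_trans (ler_norm_sum _ _ _))// mulr_suml; apply: ler_sum => j _.
by rewrite normrM ler_wpM2l.
Qed.

(* Carathéodory reduction: a dependency among the generators in [I] allows one
   to drop a generator without increasing [dotv b p]; once they are independent,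
   [p] is a linear function of [A^T *m p]. *)
Lemma caratheodory m n (A : 'M[R]_(m, n)) (I : {set 'I_m}) :
  exists2 H : R, 0 <= H & forall b y p, lev (A *m y) b -> lev 0 p ->
    (forall i, i \notin I -> p i 0 = 0) ->
    exists q, [/\ lev 0 q, A^T *m q = A^T *m p, dotv b q <= dotv b p &
      forall i, q i 0 <= H * norm1 (A^T *m p)].
Proof.
have [k] := ubnP #|I|; elim: k I => // k IH I Ik.
have [[t [tI At t0]]|indep] := pselect (exists t : 'cV[R]_m,
    [/\ forall i, i \notin I -> t i 0 = 0, A^T *m t = 0 & t != 0]); last first.
  (* [v *m E = 0] says that [v] is supported in [I], so independence of the generators in [I] makes
     [row_mx A E] row free; its right inverse recovers [p] from [A^T *m p]. *)
  pose E : 'M[R]_m := diag_mx (\row_i (i \notin I)%:R).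
  have [L ML] : exists L, row_mx A E *m L = 1%:M.
    apply/row_freeP/inj_row_free => v.
    rewrite mul_mx_row -row_mx0 => /eq_row_mx[vA vE].
    apply/trmx_inj; rewrite trmx0; apply/eqP/negP => /negP v0.
    apply: indep; exists v^T; split=> //; last by rewrite -trmx_mul vA trmx0.
    move=> i iI; have /matrixP/(_ 0 i) := vE.
    by rewrite mul_mx_diag !mxE iI mulr1.
  exists (entry_sum (usubmx L)^T) => [|b y p Ay p0 pI].
    exact: entry_sum_ge0.
  exists p; split=> // i.
  have pE : p^T *m E = 0.
    apply/matrixP => r j; rewrite mul_mx_diag !mxE.
    by case: (boolP (j \in I)) => jI; rewrite ?mulr0// (ord1 r) pI// mul0r.
  have {1}-> : p = (usubmx L)^T *m (A^T *m p).
    apply/trmx_inj; rewrite !trmx_mul !trmxK -mulmxA -[LHS]mulmx1 -ML mulmxA.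
    by rewrite mul_mx_row pE -[L in LHS]vsubmxK mul_row_col mul0mx addr0 mulmxA.
  apply: le_trans (ler_norm _) _; apply: le_trans (norm1_coord _ _) _.
  by apply: norm1_mulmx => j; exact: norm1_coord.
(* The index to be dropped depends on [b] and [p], so constants are fixed for all [i] beforehand and
   then summed. *)
have /choice[H HP] : forall i, exists H, 0 <= H /\ (i \in I ->
    forall b y p, lev (A *m y) b -> lev 0 p ->
    (forall j, j \notin I :\ i -> p j 0 = 0) ->
    exists q, [/\ lev 0 q, A^T *m q = A^T *m p, dotv b q <= dotv b p &
      forall i, q i 0 <= H * norm1 (A^T *m p)]).
  move=> i; have [iI|iI] := boolP (i \in I); last by exists 0.
  have [|H H0 HP] := IH (I :\ i); first by move: Ik; rewrite (cardsD1 i) iI.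
  by exists H; split.
exists (\sum_i H i) => [|b y p Ay p0 pI].
  by apply: sumr_ge0 => i _; case: (HP i).
have ker_ge0 s : A^T *m s = 0 -> lev 0 s -> 0 <= dotv b s.
  move=> As s0; rewrite dotvC.
  by apply: le_trans (lev_dot s0 Ay); rewrite -dotv_tr As dot0v.
(* One of [t] and [-t] works: if the sign favoured by [b] has no positive coordinate, its opposite
   is nonnegative and [ker_ge0] applies to that. *)
have [s [sI As bs [i1 i1s]]] : exists s : 'cV[R]_m,
    [/\ forall i, i \notin I -> s i 0 = 0, A^T *m s = 0, 0 <= dotv b s &
       exists i, 0 < s i 0].
  have AN : A^T *m (- t) = 0 by rewrite mulmxN At oppr0.
  have NI i : i \notin I -> (- t) i 0 = 0 by move=> /tI; rewrite mxE => ->; rewrite oppr0.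
  have pos (s : 'cV[R]_m) : ~ (exists i, 0 < s i 0) -> lev 0 (- s).
    move=> h i; rewrite !mxE oppr_ge0 leNgt; apply/negP => si.
    by apply: h; exists i.
  have [bt|bt] := leP 0 (dotv b t); last first.
    exists (- t); split=> //; first by rewrite dotvNr oppr_ge0 ltW.
    apply: contrapT => /pos; rewrite opprK => /(ker_ge0 _ At).
    by rewrite leNgt bt.
  have [tp|/pos tn] := pselect (exists i, 0 < t i 0); first by exists t.
  exists (- t); split=> //; first exact: ker_ge0.
  apply: contrapT => /pos; rewrite opprK => tp.
  case/eqP: t0; apply/matrixP => i j; rewrite (ord1 j) mxE; apply/eqP.
  rewrite eq_le; have := tn i; have := tp i; rewrite !mxE oppr_ge0.
  by move=> -> ->.
(* Ratio test: the longest step along [-s] that keeps [p] nonnegative, which makes coordinate [i0]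
   vanish. *)
pose i0 := [arg min_(i < i1 | 0 < s i 0) (p i 0 / s i 0)]%O.
have [i0s i0min] : 0 < s i0 0 /\
    forall i, 0 < s i 0 -> p i0 0 / s i0 0 <= p i 0 / s i 0.
  by rewrite /i0; case: arg_minP => // i h h'; split.
have pge i : 0 <= p i 0 by have := p0 i; rewrite mxE.
set th := p i0 0 / s i0 0 in i0min.
have th0 : 0 <= th by rewrite divr_ge0 // ltW.
have i0I : i0 \in I by apply: contraTT i0s => /sI ->; rewrite ltxx.
have [H0 /(_ i0I b y (p - th *: s) Ay)[]] := HP i0.
- move=> i; rewrite !mxE subr_ge0; have [si|si] := leP (s i 0) 0.
    by apply: le_trans (pge i); rewrite mulr_ge0_le0.
  by rewrite -ler_pdivlMr // i0min.
- move=> j; rewrite !inE negb_and negbK !mxE => /orP[/eqP->|jI].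
    by rewrite /th divfK ?subrr ?gt_eqF.
  by rewrite pI // sI // mulr0 subrr.
move=> q [q0]; rewrite mulmxBr -scalemxAr As scaler0 subr0 => Aq bq qH.
exists q; split=> //.
  by apply: le_trans bq _; rewrite dotvDr dotvNr dotvZr lerBlDr lerDl mulr_ge0.
move=> i; apply: le_trans (qH i) _; rewrite ler_wpM2r ?norm1_ge0 //.
by rewrite (bigD1 i0) //= lerDl sumr_ge0 // => j _; case: (HP j).
Qed.

End Caratheodory.

(** * Linear programming duality and Lipschitz dependence on the data *)

Section Polyhedron.
Variables (R : realType) (m n : nat) (A : 'M[R]_(m, n)).

Definition polyhedron (b : 'cV[R]_m) : set 'cV[R]_n := [set y | lev (A *m y) b].

(** The support function of the polyhedron; as a real [sup] it has the default value 0 when the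
    polyhedron is empty. *)
Definition max_dotv (u : 'cV[R]_n) b : R := sup [set dotv u y | y in polyhedron b].

Definition trivial_recession := forall z, lev (A *m z) 0 -> z = 0.

Lemma weak_duality b p y : lev 0 p -> polyhedron b y ->
  dotv (A^T *m p) y <= dotv b p.
Proof. by move=> p0 Ay; rewrite dotv_tr (dotvC b); exact: lev_dot. Qed.

Hypothesis hA : trivial_recession.

Lemma dual_feasible u : exists2 p, lev 0 p & A^T *m p = u.
Proof.
by have [//|[z /hA ->]] := farkas A u; rewrite dotv0 ltxx.
Qed.

Lemma max_dotv_ub u b y : polyhedron b y -> dotv u y <= max_dotv u b.
Proof.
move=> Ay; apply: ub_le_sup; last by exists y.
have [p p0 <-] := dual_feasible u; exists (dotv b p) => _ [z Az <-].
exact: weak_duality.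
Qed.

Lemma max_dotv_le u b M : polyhedron b !=set0 ->
  (forall y, polyhedron b y -> dotv u y <= M) -> max_dotv u b <= M.
Proof.
move=> [y Ay] h; apply: ge_sup; first by exists (dotv u y), y.
by move=> _ [z Az <-]; exact: h.
Qed.

(** The constant depends on [A] alone, which makes the later estimates uniform over scenarios. *)
Lemma bounded_strong_duality : exists2 H : R, 0 <= H &
  forall u b, polyhedron b !=set0 -> exists p, [/\ lev 0 p, A^T *m p = u,
    dotv b p = max_dotv u b & forall i, p i 0 <= H * norm1 u].
Proof.
have [H H0 HP] := caratheodory A [set: 'I_m]%SET; exists H => // u b [y Ay].
have [p [p0 Ap bp]] : exists p, [/\ lev 0 p, A^T *m p = u & dotv b p <= max_dotv u b].
  by apply: farkas_valid Ay _ => z; exact: max_dotv_ub.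
have [|q [q0 Aq bq qH]] := HP b y p Ay p0; first by move=> i; rewrite inE.
exists q; rewrite Aq Ap in qH *; split=> //; apply/eqP; rewrite eq_le.
rewrite (le_trans bq bp) /=; apply: max_dotv_le => [|z Az]; first by exists y.
by rewrite -Ap -Aq; exact: weak_duality.
Qed.

Lemma max_dotv_attained u b : polyhedron b !=set0 ->
  exists2 y, polyhedron b y & dotv u y = max_dotv u b.
Proof.
move=> b0; set M := max_dotv u b.
(* A maximiser solves [A y <= b], [u y >= M]. An infeasibility certificate [(p, l)] would bound [u]
   by [dotv b p / l < M] if [l > 0], and contradict nonemptiness if [l = 0]. *)
have [[y]|[r]] := farkas_feasible (col_mx A (- u^T)) (col_mx b (- M%:M)).
  rewrite mul_col_mx => /lev_col[Ay uy]; exists y => //.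
  apply/eqP; rewrite eq_le max_dotv_ub //=; have := uy 0.
  rewrite mulNmx [leLHS]mxE (_ : (- M%:M) 0 0 = - M) ?lerN2 //.
  by rewrite !mxE eqxx mulr1n.
rewrite -[r]vsubmxK; set p := usubmx r; set l := dsubmx r.
case=> /lev0_col[p0 l0]; rewrite tr_col_mx mul_row_col.
rewrite [l]mx11_scalar mul_mx_scalar linearN /= trmxK scalerN.
have {}l0 : 0 <= l 0 0 by have := l0 0; rewrite [X in X <= _]mxE.
move=> /eqP; rewrite subr_eq0 => /eqP Ap.
rewrite dotv_col dotv1 (_ : (- M%:M) 0 0 = - M); last by rewrite !mxE eqxx mulr1n.
rewrite (_ : (_%:M) 0 0 = l 0 0); last by rewrite [LHS]mxE eqxx mulr1n.
rewrite mulNr subr_lt0 => bp; exfalso.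
have ub y : polyhedron b y -> l 0 0 * dotv u y <= dotv b p.
  by move=> Ay; rewrite -dotvZl -Ap; exact: weak_duality.
have [l00|lpos] := leP (l 0 0) 0.
  have lz : l 0 0 = 0 by apply/eqP; rewrite eq_le l00.
  have [y /ub] := b0; rewrite lz mul0r => bp0.
  by move: bp; rewrite lz mulr0 ltNge bp0.
suff : M <= (l 0 0)^-1 * dotv b p by rewrite ler_pdivlMl // mulrC leNgt bp.
by apply: max_dotv_le => // y /ub; rewrite ler_pdivlMl.
Qed.

(** Weak duality with the bounded multipliers of the directions [u] and [-u]. *)
Lemma polyhedron_bounded : exists2 H : R, 0 <= H & forall b y,
  polyhedron b y -> forall u, `|dotv u y| <= H * norm1 u * norm1 b.
Proof.
have [H H0 HP] := bounded_strong_duality; exists H => // b y Ay u.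
have dir w : dotv w y <= H * norm1 w * norm1 b.
  have [|p [p0 <- bp pH]] := HP w b; first by exists y.
  rewrite (le_trans (weak_duality p0 Ay)) // (le_trans (ler_norm _)) // dotvC.
  apply: dotv_le_norm1 => i; rewrite ger0_norm //.
  by have := p0 i; rewrite mxE.
rewrite ler_norml dir andbT lerNl -dotvNl.
by have := dir (- u); rewrite -scaleN1r norm1Z normrN normr1 mul1r.
Qed.

(** The optimal multipliers for [(u, b)] stay dual feasible for [(u, b')], which controls the change
    of [b]; the size of feasible points controls the change of [u]. *)
Lemma max_dotv_lipschitz : exists2 H : R, 0 <= H &
  forall u u' b b', polyhedron b !=set0 -> polyhedron b' !=set0 ->
  max_dotv u' b' <= max_dotv u b + H * (norm1 u * norm1 (b' - b)
                                       + norm1 b' * norm1 (u' - u)).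
Proof.
have [H H0 HP] := bounded_strong_duality.
have [K K0 KP] := polyhedron_bounded.
exists (H + K) => [|u u' b b' b0 b'0]; first exact: addr_ge0.
have [p [p0 Ap bp pH]] := HP u b b0.
apply: max_dotv_le => // y Ay.
have -> : dotv u' y = dotv u y + dotv (u' - u) y.
  by rewrite -dotvDl addrCA subrr addr0.
have up : dotv u y <= max_dotv u b + dotv p (b' - b).
  rewrite -bp (dotvC b) -dotvDr addrCA subrr addr0 (dotvC p) -Ap.
  exact: weak_duality.
have pb : dotv p (b' - b) <= H * norm1 u * norm1 (b' - b).
  rewrite (le_trans (ler_norm _)) //; apply: dotv_le_norm1 => i.
  by rewrite ger0_norm //; have := p0 i; rewrite mxE.
have yu := le_trans (ler_norm _) (KP _ _ Ay (u' - u)).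
have ub0 : 0 <= norm1 u * norm1 (b' - b) by rewrite mulr_ge0 ?norm1_ge0.
have bu0 : 0 <= norm1 b' * norm1 (u' - u) by rewrite mulr_ge0 ?norm1_ge0.
by have := mulr_ge0 K0 ub0; have := mulr_ge0 H0 bu0; lra.
Qed.

End Polyhedron.

(** * The problem [Phi] and the pessimistic value in one scenario *)

Section Scenario.
Variables (R : realType) (d k m n : nat) (P : bilevel_data R d k m n).
Variables (x : 'cV[R]_d).
Implicit Types (xi : 'cV[R]_k) (lambda : R).
Local Notation A := (matA P).

(** The minimisation in [Phi] separates: by duality the part in [p] is the first maximum, and the
    part in [y] is [lambda] times the follower's minimal cost. *)
Definition phi lambda xi : R :=
  max_dotv A (payoff P xi - lambda *: cost P xi) (rhs P x xi) -
  lambda * max_dotv A (- cost P xi) (rhs P x xi).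

(* [y + y'] is [1 + lambda] times a feasible point, which covers [lambda = 0]. *)
Lemma scaled_cost_ge lambda xi y y' : 0 <= lambda -> Omega P x xi y ->
  lev (A *m y') (lambda *: rhs P x xi) ->
  lambda * dotv (cost P xi) y <= dotv (cost P xi) y'.
Proof.
move=> l0 [Ay ymin] Ay'; have l1 : 0 < 1 + lambda by lra.
have : dotv (cost P xi) y <= dotv (cost P xi) ((1 + lambda)^-1 *: (y + y')).
  apply: ymin; rewrite /follower_feasible /= -scalemxAr mulmxDr.
  rewrite -[X in lev _ X](scalerK (lt0r_neq0 l1)).
  apply: levZ; first by rewrite invr_ge0 ltW.
  by rewrite scalerDl scale1r; exact: levD.
by rewrite dotvZr ler_pdivlMl // dotvDr mulrDl mul1r lerD2l.
Qed.

(** Weak duality. Infeasible scenarios are covered too, the supremum over an empty [Omega] being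
    [-oo]. *)
Lemma pessimistic_le_Phi lambda xi : 0 <= lambda ->
  (pessimistic_value P x xi <= Phi P lambda x xi)%E.
Proof.
move=> l0; apply: ge_ereal_sup => _ [y Oy <-].
apply: le_ereal_inf_tmp => _ [[p y'] [/= Ap p0 Ay'] <-].
rewrite lee_fin -Ap dotvDl dotvZl; apply: lerD; last exact: scaled_cost_ge Ay'.
by apply: weak_duality => //; case: Oy.
Qed.

Hypothesis hA : trivial_recession A.

Lemma Phi_fin lambda xi : 0 <= lambda -> follower_feasible P x xi !=set0 ->
  Phi P lambda x xi = (phi lambda xi)%:E.
Proof.
move=> l0 Y0.
have [y Ay cy] := max_dotv_attained hA (- cost P xi) Y0.
have Oy : Omega P x xi y.
  split=> // z Az; rewrite -lerN2 -!dotvNl cy; exact: max_dotv_ub.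
have [H _ HP] := bounded_strong_duality hA.
have [p [p0 Ap bp _]] := HP (payoff P xi - lambda *: cost P xi) _ Y0.
apply/eqP; rewrite eq_le; apply/andP; split.
  apply: ereal_inf_lbound; exists (p, lambda *: y).
    split=> //=; first by rewrite Ap subrK.
    by rewrite -scalemxAr; exact: levZ.
  by rewrite /= bp dotvZr /phi -cy dotvNl mulrN opprK.
apply: le_ereal_inf_tmp => _ [[q y'] [/= Aq q0 Ay'] <-].
rewrite lee_fin /phi; apply: lerD.
  apply: max_dotv_le => // z Az; rewrite -Aq addrK; exact: weak_duality.
by rewrite -cy dotvNl mulrN opprK; exact: scaled_cost_ge Ay'.
Qed.

Lemma phi_anti lambda mu xi : follower_feasible P x xi !=set0 ->
  lambda <= mu -> phi mu xi <= phi lambda xi.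
Proof.
move=> Y0 lm; rewrite /phi lerBlDr; apply: max_dotv_le => // y Ay.
have := max_dotv_ub hA (payoff P xi - lambda *: cost P xi) Ay.
have /(ler_wpM2l (_ : 0 <= mu - lambda)) := max_dotv_ub hA (- cost P xi) Ay.
by rewrite subr_ge0 => /(_ lm); rewrite !(dotvDl, dotvNl, dotvZl); lra.
Qed.

(** With [phi_ge], this confines [phi] between bounds free of [lambda], as dominated convergence
    will require. *)
Lemma phi_le lambda xi : 0 <= lambda -> follower_feasible P x xi !=set0 ->
  phi lambda xi <= max_dotv A (payoff P xi) (rhs P x xi).
Proof.
move=> l0 Y0; apply: le_trans (phi_anti Y0 l0) _.
by rewrite /phi scale0r subr0 mul0r subr0.
Qed.

Lemma phi_ge lambda xi : follower_feasible P x xi !=set0 ->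
  - max_dotv A (- payoff P xi) (rhs P x xi) <= phi lambda xi.
Proof.
move=> Y0; have [y Ay cy] := max_dotv_attained hA (- cost P xi) Y0.
have := max_dotv_ub hA (payoff P xi - lambda *: cost P xi) Ay.
have := max_dotv_ub hA (- payoff P xi) Ay.
by rewrite /phi -cy !(dotvDl, dotvNl, dotvZl); lra.
Qed.

(* Farkas' lemma for the optimal face [{y : A y <= b, c y <= min}]: the
   multiplier of the last inequality is the required [lambda]. *)
Lemma pessimistic_fin xi : follower_feasible P x xi !=set0 ->
  exists2 lambda, 0 <= lambda & pessimistic_value P x xi = (phi lambda xi)%:E.
Proof.
move=> Y0; have [y Ay cy] := max_dotv_attained hA (- cost P xi) Y0.
have Oy : Omega P x xi y.
  split=> // z Az; rewrite -lerN2 -!dotvNl cy; exact: max_dotv_ub.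
have [r rE] : exists r : R, pessimistic_value P x xi = r%:E.
  have lo : ((dotv (payoff P xi) y)%:E <= pessimistic_value P x xi)%E.
    by apply: ereal_sup_ubound; exists y.
  have hi : (pessimistic_value P x xi <=
      (max_dotv A (payoff P xi) (rhs P x xi))%:E)%E.
    apply: ge_ereal_sup => _ [z [Az _] <-]; rewrite lee_fin.
    exact: max_dotv_ub.
  by case: pessimistic_value lo hi => // r; exists r.
set mu := dotv (cost P xi) y.
have muE : max_dotv A (- cost P xi) (rhs P x xi) = - mu by rewrite -cy dotvNl.
have [] := @farkas_valid _ _ _ (col_mx A (cost P xi)^T)
  (col_mx (rhs P x xi) mu%:M) (payoff P xi) y r.
- rewrite mul_col_mx; apply/lev_col; split=> // i.
  by rewrite ord1 [leRHS]mxE eqxx mulr1n.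
(* The added inequality forces [z] into [Omega], so its payoff is at most [r]. *)
- move=> z; rewrite mul_col_mx => /lev_col[Az cz].
  rewrite -lee_fin -rE; apply: ereal_sup_ubound; exists z => //; split=> // w Aw.
  apply: le_trans (_ : mu <= _); last by case: Oy => _; apply.
  by have := cz 0; rewrite [leRHS]mxE eqxx mulr1n.
move=> q; rewrite -[q]vsubmxK; set p := usubmx q; set l := dsubmx q.
case=> /lev0_col[p0 l0]; rewrite tr_col_mx mul_row_col trmxK.
rewrite [l]mx11_scalar mul_mx_scalar => Ap.
have {}l0 : 0 <= l 0 0 by have := l0 0; rewrite [leLHS]mxE.
rewrite dotv_col dotv1 !(@mxE _ _ _ _ (fun i j => _ *+ (i == j))) eqxx !mulr1n => pr.
exists (l 0 0) => //; rewrite rE; congr (_%:E); apply/eqP; rewrite eq_le.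
apply/andP; split.
  by rewrite -lee_fin -rE -Phi_fin //; exact: pessimistic_le_Phi.
apply: le_trans pr; rewrite /phi muE mulrN opprK [mu * _]mulrC; apply: lerD => //.
apply: max_dotv_le => // z Az; rewrite -Ap addrK; exact: weak_duality.
Qed.

End Scenario.

(** * Lipschitz extension of [phi] to all scenarios *)

Section Lipschitz.
Variables (R : realType).

Section McShane.
Variables (V : normedModType R) (E : set V) (f : V -> R) (L : R).
Hypotheses (L0 : 0 <= L) (E0 : E !=set0).
Hypothesis fL : forall s t, E s -> E t -> f t <= f s + L * `|t - s|.

(** McShane's formula for the smallest [L]-Lipschitz extension of [f] from [E]. *)
Definition mcshane (s : V) : R := sup [set f t - L * `|s - t| | t in E].

Let mcshane_ub s t : E t -> f t - L * `|s - t| <= mcshane s.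
Proof.
move=> Et; apply: ub_le_sup; last by exists t.
have [t0 Et0] := E0; exists (f t0 + L * `|s - t0|) => _ [u Eu <-].
have := fL Et0 Eu; have := ler_wpM2l L0 (ler_distD s u t0).
by rewrite mulrDr (distrC u s); lra.
Qed.

Let mcshane_le s M : (forall t, E t -> f t - L * `|s - t| <= M) -> mcshane s <= M.
Proof.
move=> h; apply: ge_sup => [|_ [t Et <-]]; last exact: h.
by have [t Et] := E0; exists (f t - L * `|s - t|), t.
Qed.

Lemma mcshane_id s : E s -> mcshane s = f s.
Proof.
move=> Es; apply/eqP; rewrite eq_le; apply/andP; split.
  by apply: mcshane_le => t Et; rewrite lerBlDr distrC; exact: fL.
by have := mcshane_ub s Es; rewrite subrr normr0 mulr0 subr0.
Qed.

Lemma mcshane_lipschitz s t : mcshane t <= mcshane s + L * `|t - s|.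
Proof.
apply: mcshane_le => u Eu; have := mcshane_ub s Eu.
by have := ler_wpM2l L0 (ler_distD t s u); rewrite mulrDr (distrC s t); lra.
Qed.

Lemma mcshane_dist s t : `|mcshane t - mcshane s| <= L * `|t - s|.
Proof.
have := mcshane_lipschitz s t; have := mcshane_lipschitz t s.
by rewrite (distrC s t) ler_norml => *; apply/andP; split; lra.
Qed.

Lemma mcshane_continuous : continuous mcshane.
Proof.
move=> s; apply/cvgrPdist_lt => e e0.
have L1 : 0 < L + 1 by rewrite ltr_wpDl.
have e1 : 0 < e / (L + 1) by rewrite divr_gt0.
near=> t; apply: le_lt_trans (mcshane_dist _ _) _.
have : `|s - t| < e / (L + 1) by near: t; exact: cvgr_dist_lt.
rewrite ltr_pdivlMr // => /(le_lt_trans _); apply.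
by rewrite mulrC ler_wpM2l // lerDl.
Unshelve. all: by end_near. Qed.

End McShane.

Section BoundedLipschitz.
Variables (k : nat) (S : set 'cV[R]_k).

(** The size bound is restricted to [S], since affine data are in general unbounded on the whole
    space. *)
Definition bounded_lipschitz q (a : 'cV[R]_k -> 'cV[R]_q) := exists K : R,
  [/\ 0 <= K, forall s t, norm1 (a t - a s) <= K * `|t - s| &
      forall s, S s -> norm1 (a s) <= K].

Lemma bounded_lipschitz_affine q (M : 'M[R]_(q, k)) a0 :
  bounded_set S -> bounded_lipschitz (fun s => M *m s + a0).
Proof.
move=> [r [_ /(_ (`|r| + 1))]] Sr.
have {}Sr s : S s -> `|s| <= `|r| + 1.
  by apply: Sr; have := ler_norm r; lra.
have r1 : 0 <= `|r| + 1 by have := normr_ge0 r; lra.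
have M0 := entry_sum_ge0 M.
have a00 := norm1_ge0 a0.
have coord (s : 'cV[R]_k) j : `|s j 0| <= `|s|.
  rewrite [leRHS](mx_normrE s).
  exact: (le_bigmax _ (fun ij => `|s ij.1 ij.2|) (j, 0)).
exists (entry_sum M * (`|r| + 1) + entry_sum M + norm1 a0); split.
- by rewrite !addr_ge0 ?mulr_ge0.
- move=> s t; rewrite opprD addrACA subrr addr0 -mulmxBr.
  apply: le_trans (norm1_mulmx _ (coord _)) _; rewrite ler_wpM2r //.
  by have := mulr_ge0 M0 r1; lra.
- move=> s Ss; apply: le_trans (norm1D _ _) _.
  have := norm1_mulmx M (coord s).
  by have := ler_wpM2l M0 (Sr _ Ss); lra.
Qed.

Lemma bounded_lipschitzD q (a b : 'cV[R]_k -> 'cV[R]_q) :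
  bounded_lipschitz a -> bounded_lipschitz b ->
  bounded_lipschitz (fun s => a s + b s).
Proof.
move=> [K [K0 aL aK]] [M [M0 bL bM]]; exists (K + M); split.
- exact: addr_ge0.
- move=> s t; rewrite opprD addrACA mulrDl.
  by apply: le_trans (norm1D _ _) _; exact: lerD.
- by move=> s Ss; apply: le_trans (norm1D _ _) _; rewrite lerD ?aK ?bM.
Qed.

Lemma bounded_lipschitzZ q c (a : 'cV[R]_k -> 'cV[R]_q) :
  bounded_lipschitz a -> bounded_lipschitz (fun s => c *: a s).
Proof.
move=> [K [K0 aL aK]]; exists (`|c| * K); split.
- exact: mulr_ge0.
- by move=> s t; rewrite -scalerBr norm1Z -mulrA ler_wpM2l.
- by move=> s Ss; rewrite norm1Z ler_wpM2l // aK.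
Qed.

Lemma max_dotv_bounded_lipschitz m n (A : 'M[R]_(m, n)) u b :
  trivial_recession A -> bounded_lipschitz u -> bounded_lipschitz b ->
  exists2 L, 0 <= L & forall s t, S s -> S t ->
    polyhedron A (b s) !=set0 -> polyhedron A (b t) !=set0 ->
    max_dotv A (u t) (b t) <= max_dotv A (u s) (b s) + L * `|t - s|.
Proof.
move=> hA [K [K0 uL uK]] [M [M0 bL bM]].
have [H H0 HP] := max_dotv_lipschitz hA.
exists (H * (K * M + M * K)) => [|s t Ss St bs bt].
  by rewrite mulr_ge0 // addr_ge0 // mulr_ge0.
apply: le_trans (HP (u s) _ _ _ bs bt) _; rewrite lerD2l -mulrA ler_wpM2l // mulrDl.
by apply: lerD; rewrite -mulrA; apply: ler_pM; rewrite ?norm1_ge0 ?uK ?bM.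
Qed.

Lemma max_dotv_bounded m n (A : 'M[R]_(m, n)) u b :
  trivial_recession A -> bounded_lipschitz u -> bounded_lipschitz b ->
  exists K, forall s, S s -> polyhedron A (b s) !=set0 ->
    max_dotv A (u s) (b s) <= K.
Proof.
move=> hA [K [K0 _ uK]] [M [M0 _ bM]].
have [H H0 HP] := polyhedron_bounded hA.
exists (H * K * M) => s Ss bs; apply: max_dotv_le => // y Ay.
apply: le_trans (ler_norm _) _; apply: le_trans (HP _ _ Ay _) _.
by rewrite !ler_pM ?mulr_ge0 ?norm1_ge0 ?uK ?bM.
Qed.

End BoundedLipschitz.

Section PhiLipschitz.
Variables (d k m n : nat) (P : bilevel_data R d k m n) (x : 'cV[R]_d).
Variable S : set 'cV[R]_k.
Hypotheses (hA : trivial_recession (matA P)) (hS : bounded_set S).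

Let bl_cost : bounded_lipschitz S (cost P).
Proof. exact: bounded_lipschitz_affine. Qed.

Let bl_payoff : bounded_lipschitz S (payoff P).
Proof. exact: bounded_lipschitz_affine. Qed.

Let bl_rhs : bounded_lipschitz S (rhs P x).
Proof. exact: bounded_lipschitz_affine. Qed.

Let bl_oppr (u : 'cV[R]_k -> 'cV[R]_n) :
  bounded_lipschitz S u -> bounded_lipschitz S (fun s => - u s).
Proof.
by move=> /(bounded_lipschitzZ (-1)); under eq_fun do rewrite scaleN1r.
Qed.

Lemma phi_lipschitz lambda : 0 <= lambda ->
  exists2 L, 0 <= L & forall s t, S s -> S t ->
    follower_feasible P x s !=set0 -> follower_feasible P x t !=set0 ->
    phi P x lambda t <= phi P x lambda s + L * `|t - s|.
Proof.
move=> l0.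
have bl : bounded_lipschitz S (fun s => payoff P s - lambda *: cost P s).
  by apply: bounded_lipschitzD => //; apply: bl_oppr; exact: bounded_lipschitzZ.
have [L L0 LP] := max_dotv_bounded_lipschitz hA bl bl_rhs.
have [M M0 MP] := max_dotv_bounded_lipschitz hA (bl_oppr bl_cost) bl_rhs.
exists (L + lambda * M) => [|s t Ss St Ys Yt]; first by rewrite addr_ge0 ?mulr_ge0.
have := LP _ _ Ss St Ys Yt.
have := ler_wpM2l l0 (MP _ _ St Ss Yt Ys).
by rewrite /phi (distrC s t); lra.
Qed.

Lemma phi_bounded : exists K, forall s lambda, S s ->
  follower_feasible P x s !=set0 -> 0 <= lambda -> `|phi P x lambda s| <= K.
Proof.
have [K KP] := max_dotv_bounded hA bl_payoff bl_rhs.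
have [M MP] := max_dotv_bounded hA (bl_oppr bl_payoff) bl_rhs.
exists (`|K| + `|M|) => s lambda Ss Ys l0.
have h1 := KP _ Ss Ys; have h2 := MP _ Ss Ys.
have := phi_ge hA lambda Ys; have := phi_le hA l0 Ys.
have := ler_norm K; have := ler_norm M.
have := normr_ge0 K; have := normr_ge0 M.
by rewrite ler_norml => *; apply/andP; split; lra.
Qed.

(** On infeasible scenarios [phi] takes default values and may jump; the extension replaces it by a
    function that weak convergence can test. *)
Lemma phi_extension lambda : 0 <= lambda ->
  (exists s, S s /\ follower_feasible P x s !=set0) ->
  exists2 g : 'cV[R]_k -> R, continuous g /\ (exists K, forall s, S s -> `|g s| <= K) &
    forall s, S s -> follower_feasible P x s !=set0 -> g s = phi P x lambda s.
Proof.
move=> l0 [s0 [Ss0 Ys0]]; have [L L0 LP] := phi_lipschitz l0.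
pose E := [set s | S s /\ follower_feasible P x s !=set0].
have E0 : E !=set0 by exists s0.
have EL s t : E s -> E t -> phi P x lambda t <= phi P x lambda s + L * `|t - s|.
  by move=> [Ss Ys] [St Yt]; exact: LP.
exists (mcshane E (phi P x lambda) L).
  split; first exact: mcshane_continuous.
  have [r [_ /(_ (`|r| + 1))]] := hS => Sr.
  have {}Sr s : S s -> `|s| <= `|r| + 1.
    by apply: Sr; have := ler_norm r; lra.
  set g := mcshane _ _ _.
  exists (`|g s0| + L * (`|r| + 1 + `|s0|)) => s Ss.
  have := mcshane_dist L0 E0 EL s0 s; rewrite -/g => gd.
  rewrite -[g s](subrK (g s0)) addrC (le_trans (ler_normD _ _)) // lerD2l.
  apply: le_trans gd _; rewrite ler_wpM2l // (le_trans (ler_normB _ _)) // lerD2r.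
  exact: Sr.
by move=> s Ss Ys; exact: mcshane_id.
Qed.

End PhiLipschitz.

End Lipschitz.

(** * Integrals of functions not known to be measurable *)

Section Integral.
Local Open Scope ereal_scope.
Context d (T : measurableType d) (R : realType).
Variable mu : {measure set T -> \bar R}.
Implicit Types f g h : T -> \bar R.

(** The integral of a nonnegative function is a supremum over the simple functions below it, hence
    monotone even for nonmeasurable functions. *)
Lemma integral_mono f g : (forall x, f x <= g x) ->
  \int[mu]_x f x <= \int[mu]_x g x.
Proof.
have mono u v : (forall x, 0 <= u x) -> (forall x, 0 <= v x) ->
    (forall x, u x <= v x) -> \int[mu]_x u x <= \int[mu]_x v x.
  move=> u0 v0 uv; rewrite !ge0_integralTE //; apply: ereal_sup_le.
  by move=> _ [h /= hu <-]; exists h => // x; exact: le_trans (uv x).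
move=> fg; rewrite integralE [leRHS]integralE; apply: leeB; apply: mono => //.
  by move=> x; apply: (@funepos_le _ _ setT) => //; rewrite inE.
by move=> x; apply: (@funeneg_le _ _ setT) => //; rewrite inE.
Qed.

(* Only [h] is assumed measurable: [f] is squeezed between modifications of [h]
   by [-oo] and [+oo] on a measurable null set. *)
Lemma ae_integral_eq f h : measurable_fun setT h ->
  {ae mu, forall x, f x = h x} -> \int[mu]_x f x = \int[mu]_x h x.
Proof.
move=> mh [N [mN N0 fhN]].
have mod (e : \bar R) : \int[mu]_x (if x \in N then e else h x) = \int[mu]_x h x.
  apply: ae_eq_integral => //.
    apply: measurable_fun_ifT => //.
    apply: (measurable_fun_bool true); rewrite setTI.
    by rewrite (_ : _ @^-1` _ = N) //; apply/seteqP;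
      split=> x /=; [exact: set_mem|exact: mem_set].
  exists N; split=> // x /= h'; apply: contrapT => xN; apply: h' => _.
  by rewrite memNset.
have fh x : ~ N x -> f x = h x by move=> xN; apply: contrapT => /fhN.
apply/eqP; rewrite eq_le -{1}(mod +oo) -(mod -oo).
apply/andP; split; apply: integral_mono => x; case: ifPn => [_|/negP xN].
- by rewrite leey.
- by rewrite fh // => /mem_set.
- by rewrite leNye.
- by rewrite fh // => /mem_set.
Qed.

End Integral.

(** * Bounded continuous functions and the weak topology *)

Section BoundedContinuous.
Variables (R : realType) (X : ptopologicalType).
Implicit Types (F : probability (borel X) R) (g : X -> R).

Lemma continuous_borel_measurable g : continuous g ->
  measurable_fun [set: borel X] (g : borel X -> R).
Proof.
move=> /continuousP cg; apply: (measurability _ (RGenOpens.measurableE R)).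
move=> _ [_ [a [b ->] <-]]; rewrite setTI; apply: sub_sigma_algebra.
by apply: cg; exact: interval_open.
Qed.

Lemma bounded_continuous_integrable F g : bounded_continuous g ->
  F.-integrable [set: borel X] (EFin \o g).
Proof.
move=> [cg bg]; apply: measurable_bounded_integrable => //.
- by apply: (le_lt_trans (probability_le1 F measurableT)); rewrite ltry.
- exact: continuous_borel_measurable.
Qed.

Lemma continuous_integral g : bounded_continuous g ->
  continuous ((fun F => \int[F]_(x in [set: borel X]) g x) :
    weak_probability R X -> R).
Proof.
move=> bg F; pose i : set_type (@bounded_continuous R X) := exist _ g (mem_set bg).
have -> : (fun F => \int[F]_(x in [set: borel X]) g x) =
  (proj i \o (@integrate_against R X)) by [].
apply: continuous_comp; first exact: initial_continuous.
exact: proj_continuous.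
Qed.

End BoundedContinuous.

(** * Dini's argument on a weakly compact set of measures *)

Section Dini.
Variables (R : realType) (X : ptopologicalType).
Variables (D : set (probability (borel X) R)) (g : (X -> R)^nat) (h : X -> \bar R).
Variable K : R.
Hypotheses (hD : weakly_compact D) (bg : forall j, bounded_continuous (g j)).
Hypothesis gh : forall F, D F -> {ae F, forall s : borel X,
  [/\ forall j, `|g j s| <= K,
      forall i j, (i <= j)%N -> g j s <= g i s &
      (g j s)%:E @[j --> \oo] --> h s]}.

Let int (j : nat) (F : probability (borel X) R) : R :=
  \int[F]_(s in [set: borel X]) g j s.

Let intE j (F : probability (borel X) R) :
  (\int[F]_(s in [set: borel X]) (g j s)%:E)%E = (int j F)%:E.
Proof.
rewrite /int /Rintegral fineK //.
by apply: integrable_fin_num => //; exact: bounded_continuous_integrable.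
Qed.

Let int_anti (F : probability (borel X) R) i j : D F -> (i <= j)%N -> int j F <= int i F.
Proof.
move=> DF ij; rewrite -lee_fin -!intE.
have mg k : measurable_fun [set: borel X] (EFin \o g k).
  by apply/measurable_EFinP; apply: continuous_borel_measurable; case: (bg k).
(* Passing to the maximum turns the almost sure inequality into a pointwise one. *)
have -> : (\int[F]_s (g i s)%:E = \int[F]_s maxe (g i s)%:E (g j s)%:E)%E.
  apply: ae_eq_integral => //; [exact: (mg i)|exact: (measurable_maxe (mg i) (mg j))|].
  apply: filterS (gh DF) => s [_ ganti _] _.
  by rewrite /= max_l // lee_fin ganti.
by apply: integral_mono => s; rewrite le_max lexx orbT.
Qed.

Let cvg_int (F : probability (borel X) R) : D F ->
  (int j F)%:E @[j --> \oo] --> (\int[F]_s h s)%E.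
Proof.
move=> DF; under eq_fun do rewrite -intE.
have mg k : measurable_fun [set: borel X] (EFin \o g k).
  by apply/measurable_EFinP; apply: continuous_borel_measurable; case: (bg k).
(* A measurable version of [h], to which dominated convergence applies. *)
pose h' (s : borel X) := limn_esup (fun j => (g j s)%:E).
have hh' : {ae F, forall s : borel X, h s = h' s}.
  apply: filterS (gh DF) => s [_ _ gs]; rewrite /h' limn_esup_lim.
  by have /cvg_lim -> := cvg_esups gs.
have mh' : measurable_fun setT h' by exact: measurable_fun_limn_esup.
rewrite (ae_integral_eq mh' hh').
have [|||//] := @dominated_convergence _ _ _ F setT measurableT
  (fun j s => (g j s)%:E) h' (cst K%:E) mg mh'.
- by apply: filterS2 hh' (gh DF) => s <- [].
- apply/integrableP; split=> //; rewrite integral_cst //=.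
  by rewrite (@probability_setT _ _ _ F) mule1 ltry.
- by apply: filterS (gh DF) => s [gK _ _] j _; rewrite lee_fin.
Qed.

Lemma dini_worst_case (alpha : R) :
  (forall F, D F -> \int[F]_s h s < alpha%:E)%E ->
  exists j, forall F, D F -> (\int[F]_s (g j s)%:E < alpha%:E)%E.
Proof.
move=> halpha.
have /compact_near_coveringP/(_ nat \oo) hcov := hD.
pose Q j (F : weak_probability R X) := D F -> int j F < alpha.
have [|j _ jQ] := hcov Q _; last first.
  exists j => F DF; rewrite intE lte_fin; exact: (jQ j (leqnn j)).
move=> F DF.
have [j0 _ hj0] : \forall j \near \oo, ((int j F)%:E < alpha%:E)%E.
  exact: (cvg_int DF (open_ereal_lt' (halpha F DF))).
have {}hj0 : int j0 F < alpha by rewrite -lte_fin; exact: (hj0 j0 (leqnn j0)).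
have near_F : nbhs (F : weak_probability R X) [set G | int j0 G < alpha].
  exact: (cvgr_lt _ (@continuous_integral _ _ _ (bg j0) F) _ hj0).
exists ([set G | int j0 G < alpha], [set j | (j0 <= j)%N]).
  by split=> //=; exists j0.
move=> [G j] /= [hG hj] DG; exact: le_lt_trans (int_anti DG hj) hG.
Qed.

End Dini.

(** * Exchange of infimum and supremum, and the equivalence *)

Section Equivalence.
Variables (R : realType) (d k m n : nat) (P : bilevel_data R d k m n).

Lemma bounded_feasible_recession x xi : follower_feasible P x xi !=set0 ->
  bounded_set (follower_feasible P x xi) -> trivial_recession (matA P).
Proof.
move=> [y Ay] [M [_ /(_ (`|M| + 1))]] YM z Az.
have {}YM w : follower_feasible P x xi w -> `|w| <= `|M| + 1.
  by apply: YM; have := ler_norm M; lra.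
apply/eqP/negP => /negP z0; have nz : 0 < `|z| by rewrite normr_gt0.
(* Long enough that [y + r *: z] has norm at least [|M| + 2], beyond the bound. *)
pose r := (`|M| + 2 + `|y|) / `|z|.
have r0 : 0 <= r.
  by rewrite divr_ge0 // addr_ge0 // addr_ge0.
have : `|y + r *: z| <= `|M| + 1.
  apply: YM; rewrite /follower_feasible /= mulmxDr -scalemxAr.
  by rewrite -[X in lev _ X]addr0 -(scaler0 _ r); apply: levD => //; exact: levZ.
have := lerB_normD (r *: z) y; rewrite (addrC _ y) normrZ (ger0_norm r0).
by rewrite /r divfK ?gt_eqF //; lra.
Qed.

(** Testing against real thresholds also covers [W = -oo], which occurs for empty [D]. *)
Lemma lee_addl_gtP (w : R) (I W : \bar R) :
  (forall a : R, (W < a%:E)%E -> (I <= w%:E + a%:E)%E) -> (I <= w%:E + W)%E.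
Proof.
case: W => [r| |] h; last 2 first.
- by rewrite addey // leey.
- rewrite addeNy leeNy_eq; apply/eqP/eq_ninfty => a.
  by have := h (a - w) (ltNyr _); rewrite -EFinD addrC subrK.
apply/lee_addgt0Pr => e e0; rewrite -addeA -EFinD; apply: h.
by rewrite lte_fin ltrDl.
Qed.

Variables (S : set 'cV[R]_k) (s0 : S).
Local Notation X := (pointed_subspace s0).
Variable D : set (probability (borel X) R).

Lemma worst_case_pessimistic_le_Phi lambda x : 0 <= lambda ->
  (worst_case D (pessimistic_value P x) <= worst_case D (Phi P lambda x))%E.
Proof.
move=> l0; apply: ge_ereal_sup => _ [F DF <-]; apply: le_ereal_sup_tmp.
exists (\int[F]_s Phi P lambda x (set_val s))%E; first by exists F.
by apply: integral_mono => s; exact: pessimistic_le_Phi.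
Qed.

Lemma bounded_continuous_restrict (g : 'cV[R]_k -> R) K : continuous g ->
  (forall s, S s -> `|g s| <= K) ->
  bounded_continuous (fun s : X => g (set_val s)).
Proof.
move=> cg gK; split.
  move=> s; apply: (@continuous_comp _ _ _ (set_val : X -> 'cV[R]_k) g).
    exact: initial_continuous.
  exact: cg.
exists K; split; first exact: num_real.
by move=> M KM s _ /=; apply: le_trans (gK _ (set_valP s)) (ltW KM).
Qed.

Hypotheses (hS : compact S) (hD : weakly_compact D).
Hypothesis hrecourse : relatively_complete_recourse P D.

(** Along integer [lambda] the values decrease to the pessimistic one, so Dini's argument gives one
    [lambda] serving every [F] in [D]. *)
Lemma worst_case_Phi_lt x (a : R) : leader_set P x ->
  (worst_case D (pessimistic_value P x) < a%:E)%E ->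
  exists2 lambda, 0 <= lambda & (worst_case D (Phi P lambda x) <= a%:E)%E.
Proof.
move=> Xx Wa.
have [[F0 DF0]|D0] := pselect (D !=set0); last first.
  exists 0 => //; apply: ge_ereal_sup => y [F DF _].
  by exfalso; apply: D0; exists F.
(* An almost sure property holds somewhere; one such scenario yields [trivial_recession], which
   concerns [A] only. *)
have [s1 [Y1 b1]] : exists s : X, follower_feasible P x (set_val s) !=set0 /\
    bounded_set (follower_feasible P x (set_val s)).
  have PF : ProperFilter (almost_everywhere F0).
    apply: ae_properfilter_algebraOfSetsType.
    by rewrite [ltRHS](@probability_setT _ _ _ F0) lte01.
  exact: (@filter_ex _ _ PF _ (hrecourse Xx DF0)).
have hA := bounded_feasible_recession Y1 b1.
have bS : bounded_set S := compact_bounded hS.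
have /choice[g gP] : forall j : nat, exists g : 'cV[R]_k -> R,
    [/\ continuous g, exists K, forall s, S s -> `|g s| <= K &
      forall s, S s -> follower_feasible P x s !=set0 -> g s = phi P x j%:R s].
  move=> j; have [||g [cg bg] gphi] := @phi_extension _ _ _ _ _ P x S hA bS j%:R.
  - exact: ler0n.
  - by exists (set_val s1); split=> //; exact: set_valP.
  - by exists g; split.
have [K KP] := phi_bounded x hA bS.
have bg j : bounded_continuous (fun s : X => g j (set_val s)).
  by have [cg [M gM] _] := gP j; exact: bounded_continuous_restrict gM.
have gphi j (s : X) : follower_feasible P x (set_val s) !=set0 ->
    g j (set_val s) = phi P x j%:R (set_val s).
  by have [_ _ h] := gP j; apply: h; exact: set_valP.
have [|F DF|j jP] := @dini_worst_case R X D (fun j s => g j (set_val s))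
  (fun s => pessimistic_value P x (set_val s)) K hD bg _ a.
- move=> F DF; apply: filterS (hrecourse Xx DF) => s [Y0 _]; split.
  + by move=> j; rewrite gphi //; apply: KP => //; exact: set_valP.
  + by move=> i j ij; rewrite !gphi //; apply: phi_anti => //; rewrite ler_nat.
  (* The sequence is constant once [j >= l], squeezed between weak duality and monotonicity. *)
  + have [l l0 pl] := pessimistic_fin hA Y0.
    apply: cvg_near_cst; near=> j; rewrite gphi //; apply/eqP; rewrite eq_le.
    apply/andP; split; last by rewrite -Phi_fin //; exact: pessimistic_le_Phi.
    rewrite pl lee_fin; apply: phi_anti => //.
    near: j; exact: nbhs_infty_ger.
- apply: le_lt_trans Wa; apply: ereal_sup_ubound; by exists F.
exists j%:R => //; apply: ge_ereal_sup => _ [F DF <-].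
apply: le_trans (ltW (jP F DF)).
rewrite (@ae_integral_eq _ _ _ F _ (fun s : borel X => (g j (set_val s))%:E)) //.
  apply/measurable_EFinP; apply: continuous_borel_measurable; by case: (bg j).
apply: filterS (hrecourse Xx DF) => s [Y0 _].
by rewrite Phi_fin // gphi.
Unshelve. all: by end_near. Qed.

(** One inequality is weak duality under the integral, the other the Dini exchange; no minimiser
    [lambda] is claimed. *)
Lemma two_stage_objective_inf x : leader_set P x ->
  ereal_inf [set two_stage_objective P D x lambda | lambda in [set l : R | 0 <= l]]
  = bilevel_objective P D x.
Proof.
move=> Xx; apply/eqP; rewrite eq_le; apply/andP; split.
  apply: lee_addl_gtP => a /(worst_case_Phi_lt Xx)[l l0 la].
  apply: ge_ereal_inf; exists (two_stage_objective P D x l); first by exists l.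
  exact: leeD2l.
apply: le_ereal_inf_tmp => _ [l l0 <-]; apply: leeD2l.
exact: worst_case_pessimistic_le_Phi.
Qed.

End Equivalence.

Theorem corollary1 (R : realType) (d k m n : nat)
    (P : bilevel_data R d k m n)
    (S : set 'cV[R]_k) (s0 : S)
    (D : set (probability (borel (pointed_subspace s0)) R))
    (hX : binary_leader P)
    (hS : compact S)
    (hDconvex : convex_probabilities D)
    (hDcompact : weakly_compact D)
    (hsquare : square_integrable_data P D)
    (hrecourse : relatively_complete_recourse P D) :
  equivalent_programs P D.
Proof.
have key := two_stage_objective_inf hS hDcompact hrecourse.
have optval : bilevel_optval P D = two_stage_optval P D.
  apply/eqP; rewrite eq_le; apply/andP; split; apply: le_ereal_inf_tmp.
    move=> _ [[x l] [/= Xx l0] <-].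
    apply: (@le_trans _ _ (bilevel_objective P D x)).
      by apply: ereal_inf_lbound; exists x.
    by rewrite -key //; apply: ereal_inf_lbound; exists l.
  move=> _ [x Xx <-]; rewrite -key //; apply: le_ereal_inf_tmp => _ [l l0 <-].
  by apply: ereal_inf_lbound; exists (x, l).
split=> // x; rewrite /bilevel_optimal /two_stage_optimal optval.
by split=> -[Xx]; rewrite key.
Qed.
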